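(* Let $r\ge2$, $t=2r-1$, and let $1\le l_0\le r-1$. Suppose $f$ is smooth in $[x_{j-r},x_{j+r-1}]\setminus\Omega$ and $f$ has a discontinuity at $\Omega$ (no discontinuity if $\Omega=\emptyset$). Let $\hat f_{j-\frac12}=\sum_{k=0}^{r-1}\omega_k\,p^r_k(x_{j-\frac12})$. Then, as $h\to0$, $$\hat f_{j-\frac12}-f_{j-\frac12}=\begin{cases}O(h^{2r}), & \text{if }\Omega=\emptyset;\\ O(h^{r+l_0}), & \text{if }\Omega=[x_{j-l_0-1},x_{j-l_0}]\text{ or }\Omega=[x_{j+l_0-1},x_{j+l_0}].\end{cases}$$
   Context: Fix an integer $r\ge 2$. Let $f:[0,1]\to\mathbb{R}$, $h=1/N$, $x_i=ih$, $f_i=f(x_i)$, $x_{j-\frac12}=(j-\frac12)h$, $f_{j-\frac12}=f(x_{j-\frac12})$; $j$ is such that $0\le j-r$ and $j+r-1\le N$. For integers $a\ge1$ and $b$, let $S^a_b=\{x_{j+b-a},\dots,x_{j+b}\}$ and let $p^a_b$ be the polynomial of degree at most $a$ interpolating $f$ at the nodes of $S^a_b$. Optimal weights: for $r\le a\le 2r-1$ and $a-r\le b\le r-1$, $C^a_{b,k}$, $b-(a-r)\le k\le b$, are the constants (depending only on $r,a,b,k$) such that for all data $p^a_b(x_{j-\frac12})=\sum_{k=b-(a-r)}^{b}C^a_{b,k}\,p^r_k(x_{j-\frac12})$ and $\sum_k C^a_{b,k}=1$; for other $0\le k\le r-1$ set $C^a_{b,k}=0$. Nonlinear weights: with $t=2r-1$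 and $J_\xi=|f_{j+\xi}-f_{j+\xi-1}|^{2t}$ for $-r+1\le\xi\le r-1$, define for $0\le k\le r-1$ $$\alpha_k=C^{2r-1}_{r-1,k}+h^{-t}\sum_{l=k+1}^{r-1}C^{r+l-1}_{l-1,k}J_l+h^{-t}\sum_{l=0}^{k-1}C^{2r-l-2}_{r-1,k}J_{-r+1+l},\qquad \omega_k=\frac{\alpha_k}{\sum_{\xi=0}^{r-1}\alpha_\xi}.$$ Asymptotic conventions: $O(\cdot)$ is as $h\to0$ with $f$ fixed ($j$ may depend on $h$), with constants independent of $h$ and $j$. ''Smooth'' means as many bounded continuous derivatives as needed (e.g. $C^\infty$). ''$f$ has a discontinuity at $[x_m,x_{m+1}]$ and is smooth in the rest of $[x_{j-r},x_{j+r-1}]$'' means: there are a fixed point $x^*\in[x_m,x_{m+1}]$ and fixed smooth functions $f^-,f^+$ on $[0,1]$, independent of $h$, with $f^-(x^* )\ne f^+(x^* )$ (a jump), such that within $[x_{j-r},x_{j+r-1}]$ one has $f=f^-$ on points $\le x_m$ and $f=f^+$ on points $\ge x_{m+1}$. *)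

(* Defs.v *)
From HB Require Import structures.
From mathcomp Require Import all_boot all_order all_algebra.
From mathcomp Require Import all_classical all_reals all_analysis.

Set Implicit Arguments.
Unset Strict Implicit.
Unset Printing Implicit Defensive.

Import Order.TTheory GRing.Theory Num.Theory.
Import numFieldNormedType.Exports.

Local Open Scope classical_set_scope.
Local Open Scope ring_scope.

Section Grid.
Context {R : realType}.

Definition step (N : nat) : R := N%:R^-1.

Definition node (N : nat) (i : int) : R := i%:~R * step N.

Definition midpoint (N : nat) (j : int) : R := (j%:~R - 2^-1) * step N.

Definition admissible (r N : nat) (j : int) : Prop :=
  0 <= j - r%:Z /\ j + r%:Z - 1 <= N%:Z.

Definition interpolates (f : R -> R) (N : nat) (j : int) (a : nat) (b : int)
    (p : {poly R}) : Prop :=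
  (size p <= a.+1)%N /\
  forall i : nat, (i <= a)%N ->
    p.[node N (j + b - a%:Z + i%:Z)] = f (node N (j + b - a%:Z + i%:Z)).

(* The polynomial p^a_b. For N > 0 the nodes are distinct, so exactly one
   polynomial satisfies [interpolates] and the default value is not used. *)
Definition interp_poly (f : R -> R) (N : nat) (j : int) (a : nat) (b : int) :
    {poly R} :=
  xget 0 [set p : {poly R} | interpolates f N j a b p].

(* c is the family (C^a_{b,k})_k. It is chosen before the data (f, N, j), and
   it vanishes outside b - (a - r) <= k <= b. *)
Definition is_optimal_weights (r a b : nat) (c : nat -> R) : Prop :=
  [/\ forall k : nat, ~~ (b - (a - r) <= k <= b)%N -> c k = 0,
      \sum_(b - (a - r) <= k < b.+1) c k = 1
    & forall (f : R -> R) (N : nat) (j : int), admissible r N j ->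
        (interp_poly f N j a b%:Z).[midpoint N j] =
        \sum_(b - (a - r) <= k < b.+1)
          c k * (interp_poly f N j r k%:Z).[midpoint N j]].

(* The constants C^a_{b,k}; meaningful for r <= a <= 2r-1, a-r <= b <= r-1. *)
Definition optimal_weight (r a b k : nat) : R :=
  xget (fun=> 0) [set c : nat -> R | is_optimal_weights r a b c] k.

Section Weno.
Variables (r : nat) (f : R -> R) (N : nat) (j : int).

Definition texp : nat := (2 * r - 1)%N.

Definition J (xi : int) : R :=
  `|f (node N (j + xi)) - f (node N (j + xi - 1))| ^+ (2 * texp).

Definition alpha (k : nat) : R :=
  optimal_weight r (2 * r - 1) (r - 1) k
  + step N ^- texp *
      \sum_(k.+1 <= l < r) optimal_weight r (r + l - 1) (l - 1) k * J l%:Z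
  + step N ^- texp *
      \sum_(0 <= l < k) optimal_weight r (2 * r - l - 2) (r - 1) k
                        * J (- r%:Z + 1 + l%:Z).

Definition omega (k : nat) : R := alpha k / \sum_(0 <= xi < r) alpha xi.

Definition fhat : R :=
  \sum_(0 <= k < r) omega k * (interp_poly f N j r k%:Z).[midpoint N j].

End Weno.

(* f is continuous on [u, v] and has continuous derivatives up to order n on
   ]u, v[, those of orders 1, ..., n being bounded by M. *)
Definition smooth_bound (n : nat) (M u v : R) (f : R -> R) : Prop :=
  [/\ {within `[u, v], continuous f},
      forall (i : nat) (x : R), (i < n)%N -> u < x < v ->
        derivable (derive1n i f) x 1,
      forall (i : nat) (x : R), (i <= n)%N -> u < x < v ->
        {for x, continuous (derive1n i f)}
    & forall (i : nat) (x : R), (0 < i <= n)%N -> u < x < v ->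
        `|derive1n i f x| <= M].

Definition smooth01 (n : nat) (f : R -> R) : Prop :=
  exists M : R, smooth_bound n M 0 1 f.

(* f jumps at [x_m, x_{m+1}], at the point xs, and in the rest of the window
   [x_{j-r}, x_{j+r-1}] it agrees with fm on the left and fp on the right;
   the values of f inside ]x_m, x_{m+1}[ are unconstrained. *)
Definition jump_in_window (r : nat) (f fm fp : R -> R) (xs : R)
    (N : nat) (j m : int) : Prop :=
  node N m <= xs <= node N (m + 1) /\
  forall y : R, node N (j - r%:Z) <= y <= node N (j + r%:Z - 1) ->
    (y <= node N m -> f y = fm y) /\ (node N (m + 1) <= y -> f y = fp y).

End Grid.

(* Main.v *)
Require Import Defs.
From HB Require Import structures.
From mathcomp Require Import all_boot all_order all_algebra.
From mathcomp Require Import all_classical all_reals all_analysis.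
From mathcomp Require Import ring lra zify.

Set Implicit Arguments.
Unset Strict Implicit.
Unset Printing Implicit Defensive.

Import Order.TTheory GRing.Theory Num.Theory.
Import numFieldNormedType.Exports.

Local Open Scope classical_set_scope.
Local Open Scope ring_scope.

(** Write [h] for the step and [p_k] for the interpolant on the small stencil [k].
    The reconstruction is the average of the [p_k(x_{j-1/2})] with weights
    proportional to [alpha_k].  In every case [alpha_k = A (C_k + O(h^t))] for a
    common factor [A > 0], where [C] is the family of optimal weights of one larger
    stencil that contains no jump ([weighted_average_error], [fhat_error]).  Up to a
    constant factor, the error is therefore at most that of the interpolant on this
    larger stencil, plus [h^t] times the largest error of the [p_k].

    When [f] is smooth all sensors [J_xi] are [O(h^(2t))].  So [A = 1], the larger
    stencil is the full one, with error [O(h^(2r))], and the other term is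
    [O(h^(t+r+1))].

    When [f] jumps in [x_{j+c-1}, x_{j+c}] with [c = l0] or [c = -l0], the single
    sensor [J_c] is bounded below while the others are [O(h^(2t))].  So
    [A = h^-t J_c], and [C] belongs to the stencil of [r + l0] nodes that ends just
    before the jump, or begins just after it ([sensor_term_right],
    [sensor_term_left]); its error is [O(h^(r+l0))].  The [p_k] that cross the jump
    are bounded, and [t = 2r - 1 >= r + l0].

    Three facts support this.  The interpolation error comes from repeated
    applications of Rolle's theorem ([lagrange_remainder]); on a single node it gives
    the Lipschitz bound behind the estimates of the sensors.  Optimal weights exist
    because Neville's recursion, evaluated at the midpoint, has coefficients
    independent of the grid ([optimal_weights_exist]).  The same recursion bounds the
    interpolants of bounded data ([interp_stable]). *)

(** * Repeated Rolle theorem and interpolation error *)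

Section Rolle.
Context {R : realType}.
Implicit Types (u v x y : R) (s : seq R).

(** Rolle on each gap between consecutive zeros.  The sortedness of the zeros
    found is part of the conclusion so that the lemma can be iterated. *)
Lemma zeros_of_derivative (g g' : R -> R) y s :
    path <%R y s -> {within `[y, last y s], continuous g} ->
    (forall x, y < x < last y s -> is_derive x 1 g (g' x)) ->
    g y = 0 -> {in s, forall x, g x = 0} ->
  exists s' : seq R, [/\ size s' = size s, path <%R y s',
    {in s', forall x, x < last y s} & {in s', forall x, g' x = 0}].
Proof.
elim: s y => [|z s IH] y /=; first by exists [::].
case/andP=> yz zs cg dg gy gs.
have zl : z <= last z s.
  have /= := zs; rewrite lt_path_sortedE => /andP[/allP zs' _].
  by move: (mem_last z s); rewrite inE => /predU1P[->//|/zs'/ltW].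
have [|x xzl|||s' [ss' zs' s'l g's']] := IH z zs.
- apply: continuous_subspaceW cg => x /=; rewrite !in_itv/= => /andP[zx ->].
  by rewrite (le_trans (ltW yz)).
- by apply: dg; case/andP: xzl => zx ->; rewrite (lt_trans yz).
- by apply: gs; rewrite mem_head.
- by move=> x xs; apply: gs; rewrite inE xs orbT.
have [|||w] := @Rolle R g y z yz.
- move=> x; rewrite in_itv/= => /andP[yx xz].
  have xyl : y < x < last z s by rewrite yx (lt_le_trans xz).
  by have /(@ex_derive) := dg x xyl.
- apply: continuous_subspaceW cg => x /=; rewrite !in_itv/= => /andP[->/= xz].
  exact: le_trans zl.
- by rewrite gy gs// mem_head.
rewrite in_itv/= => /andP[yw wz] dw.
have wl : w < last z s by exact: lt_le_trans zl.
exists (w :: s'); split=> //=; first by rewrite ss'.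
- rewrite yw/=; case: s' zs' {ss' s'l g's'} => //= a s' /andP[za ->].
  by rewrite (lt_trans wz).
- by move=> x; rewrite inE => /predU1P[->//|/s'l].
- move=> x; rewrite inE => /predU1P[->|/g's'//].
  have ywl : y < w < last z s by rewrite yw.
  by have /@derive_val := dg w ywl; have /@derive_val -> := dw.
Qed.

(** The derivatives are given as a chain [G] rather than by iterating the
    derivation operator: a difference of a function and a polynomial then needs
    only the derivative of a difference at each level.  Only [G 0] has to be
    continuous at the end points, since the zeros of [G 1] are interior. *)
Lemma iterated_rolle (G : nat -> R -> R) n y s :
    path <%R y s -> size s = n.+1 ->
    {within `[y, last y s], continuous (G 0%N)} ->
    (forall i x, (i < n.+1)%N -> y < x < last y s ->
       is_derive x 1 (G i) (G i.+1 x)) ->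
    {in y :: s, forall x, G 0%N x = 0} ->
  exists2 x, y < x < last y s & G n.+1 x = 0.
Proof.
elim: n G y s => [|n IH] G y s ys sn cG dG Gs.
all: have [||s' [ss' ys' s'l Gs']] := zeros_of_derivative ys cG (dG 0%N ^~ isT).
1,4: by apply: Gs; rewrite mem_head.
1,3: by move=> x xs; apply: Gs; rewrite inE xs orbT.
all: case: s' ss' ys' s'l Gs' => [|w s']; first by rewrite sn.
- move=> _ /= /andP[yw _] wl Gw; exists w; last by rewrite Gw// mem_head.
  by rewrite yw wl// mem_head.
rewrite sn => /= -[ss'] /andP[yw ws'] s'l Gs'.
have inner x : x <= last w s' -> x < last y s.
  by move=> xl; rewrite (le_lt_trans xl)// s'l// mem_last.
have [|i x ni /andP[wx xl]|//|x /andP[wx xl] Gx] :=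
    IH (fun i => G i.+1) w s' ws' ss'.
- apply: derivable_within_continuous => x; rewrite in_itv/= => /andP[wx xl].
  have yxl : y < x < last y s by rewrite (lt_le_trans yw wx) inner.
  by have /@ex_derive := dG 1%N x isT yxl.
- by apply: dG => //; rewrite (lt_trans yw wx) inner// ltW.
- by exists x => //; rewrite (lt_trans yw wx) inner// ltW.
Qed.

Lemma derivn_monic (w : {poly R}) n :
  w \is monic -> size w = n.+1 -> w^`(n) = (n`!%:R)%:P.
Proof.
move=> /monicP wm sw; apply/polyP => i; rewrite coef_derivn coefC.
case: i => [|i] /=.
  by rewrite addn0 ffactnn -[w`_n]/(w`_n.+1.-1) -sw -/(lead_coef w) wm.
by rewrite nth_default ?mul0rn// sw addnS ltnS leq_addr.
Qed.

(** Cauchy's form of the interpolation error.  The polynomial [q] below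
    interpolates [f] at [y] as well as on [s]; hence [f - q] has [size s + 1]
    zeros, its derivative of order [size s] vanishes somewhere, and there the
    derivative of [f] is [(size s)!] times the leading coefficient [c] of
    [q - p]. *)
Lemma lagrange_remainder (f : R -> R) n M u v (p : {poly R}) s y :
    smooth_bound n M u v f -> uniq s -> (0 < size s <= n)%N ->
    {in s, forall x, u <= x <= v} -> u <= y <= v ->
    (size p <= size s)%N -> {in s, forall x, p.[x] = f x} ->
  `|p.[y] - f y| <= M * \prod_(x <- s) `|y - x|.
Proof.
move=> [cf df _ bf] us /andP[s0 sn] suv yuv sp ps.
have [ys|ys] := boolP (y \in s).
  by rewrite ps// subrr normr0 (big_rem y)//= subrr normr0 mul0r mulr0.
pose w : {poly R} := \prod_(x <- s) ('X - x%:P).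
have wy : w.[y] = \prod_(x <- s) (y - x).
  by rewrite horner_prod; apply: eq_bigr => x _; rewrite hornerXsubC.
have wy0 : w.[y] != 0 by rewrite -[_ == 0]/(root w y) root_prod_XsubC.
pose c := (f y - p.[y]) / w.[y].
pose q := p + c *: w.
have qy : q.[y] = f y by rewrite hornerD hornerZ divfK// addrC subrK.
have qs : {in s, forall x, q.[x] = f x}.
  move=> x xs; rewrite hornerD hornerZ ps//.
  by have /rootP -> : root w x; rewrite ?root_prod_XsubC// mulr0 addr0.
pose G i x := derive1n i f x - q^`(i).[x].
have srt : sorted <%R (sort <=%R (y :: s)) by rewrite sort_lt_sorted/= ys.
have smem : sort <=%R (y :: s) =i y :: s by exact: mem_sort.
have := size_sort <=%R (y :: s).
case: (sort _ _) srt smem => [|z z'] //= zz' zmem [zs].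
have zuv x : x \in z :: z' -> u <= x <= v.
  by rewrite zmem inE => /predU1P[->//|/suv].
have /andP[uz _] := zuv z (mem_head _ _).
have /andP[_ lv] := zuv _ (mem_last z z').
have [||i x iz /andP[zx xl]|x|x /andP[zx xl] Gx] :=
    @iterated_rolle G (size s).-1 z z' zz'.
- by rewrite prednK.
- apply: (@continuous_subspaceW _ _ _ `[u, v]).
    move=> x /=; rewrite !in_itv/= => /andP[zx xl].
    by rewrite (le_trans uz)//= (le_trans xl).
  apply: within_continuousB; first exact: cf.
  by apply: continuous_subspaceT => x; exact: continuous_horner.
- have uxv : u < x < v by rewrite (le_lt_trans uz)// (lt_le_trans xl).
  rewrite prednK// in iz.
  have dfx := df i x (leq_trans iz sn) uxv.
  rewrite /G derive1nS derivnS derive1E.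
  apply: is_deriveB.
  exact: DeriveDef.
- rewrite zmem inE /G/= => /predU1P[->|xs].
    by rewrite qy subrr.
  by rewrite qs// subrr.
have uxv : u < x < v by rewrite (le_lt_trans uz)// (lt_le_trans xl).
rewrite prednK// in Gx.
have qE : q^`(size s) = (c * (size s)`!%:R)%:P.
  rewrite derivnD derivn_poly0// add0r derivnZ derivn_monic ?size_prod_XsubC//.
    by rewrite -mul_polyC -polyCM.
  exact: monic_prod_XsubC.
have : `|c| <= M.
  have := bf (size s) x; rewrite s0 sn => /(_ isT uxv); apply: le_trans.
  move/eqP: Gx; rewrite /G subr_eq0 => /eqP ->; rewrite qE hornerC [leRHS]normrM.
  by rewrite ler_peMr// normr_nat ler1n fact_gt0.
rewrite /c normrM normfV ler_pdivrMr ?normr_gt0// distrC.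
by rewrite wy normr_prod.
Qed.
(** The form in which the remainder is used; [`|M|] avoids having to exclude a
    negative [M] when the interval is degenerate. *)
Lemma interpolation_error (f : R -> R) n M u v (p : {poly R}) s y d :
    smooth_bound n M u v f -> uniq s -> (0 < size s <= n)%N ->
    {in s, forall x, u <= x <= v} -> u <= y <= v ->
    (size p <= size s)%N -> {in s, forall x, p.[x] = f x} ->
    {in s, forall x, `|y - x| <= d} ->
  `|p.[y] - f y| <= `|M| * d ^+ size s.
Proof.
move=> sf us sn suv yuv sp ps sd.
apply: (le_trans (lagrange_remainder sf us sn suv yuv sp ps)).
have prod_ge0 : 0 <= \prod_(x <- s) `|y - x| by exact: prodr_ge0.
apply: (le_trans (ler_wpM2r prod_ge0 (ler_norm M))).
rewrite ler_wpM2l//; elim: s sd {us sn suv sp ps prod_ge0} => [|x s IH] sd.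
  by rewrite big_nil.
rewrite big_cons exprS ler_pM//; first exact: prodr_ge0.
  by rewrite sd// mem_head.
by apply: IH => z zs; rewrite sd// inE zs orbT.
Qed.

End Rolle.

(** * Interpolating polynomials, Neville recursion and optimal weights *)

Section Interpolation.
Context {R : realType}.
Implicit Types (f : R -> R) (p q : {poly R}) (N : nat) (j b : int).

Lemma step_gt0 N : (0 < N)%N -> 0 < step N :> R.
Proof. by move=> N0; rewrite invr_gt0 ltr0n. Qed.

Lemma node_inj N : (0 < N)%N -> injective (@node R N).
Proof.
by move=> /step_gt0/lt0r_neq0 h0 i k /(mulIf h0)/intr_inj.
Qed.

Lemma interpolates_unique f N j a b p q : (0 < N)%N ->
  interpolates f N j a b p -> interpolates f N j a b q -> p = q.
Proof.
move=> N0 [sp ep] [sq eq]; apply/eqP; rewrite -subr_eq0; apply/contraT => pq0.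
pose s : seq R := [seq node N (j + b - a%:Z + i%:Z) | i <- iota 0 a.+1].
have us : uniq s.
  by rewrite map_inj_in_uniq ?iota_uniq// => x y _ _ /(node_inj N0); lia.
have rs : all (root (p - q)) s.
  apply/allP => x /mapP[i]; rewrite mem_iota add0n ltnS => /andP[_ ia] ->.
  by rewrite rootE hornerD hornerN ep// eq// subrr.
have := max_poly_roots pq0 rs us.
rewrite size_map size_iota => /leq_trans /(_ (size_polyD _ _)).
by rewrite size_polyN leq_max !ltnNge sp sq.
Qed.

(** Neville's recursion.  At the first node only [q] contributes, at the last
    one only [p], and in between [p] and [q] agree with [f]. *)
Lemma neville_interpolates f N j a b p q : (0 < N)%N ->
  interpolates f N j a b p -> interpolates f N j a (b - 1) q ->
  interpolates f N j a.+1 b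
    ((a.+1%:R * step N)^-1 *: (('X - (node N (j + b - a.+1%:Z))%:P) * p
                               - ('X - (node N (j + b))%:P) * q)).
Proof.
move=> N0 [sp ep] [sq eq].
have h0 : step N != 0 :> R by rewrite gt_eqF// step_gt0.
have a0 : a.+1%:R != 0 :> R by rewrite pnatr_eq0.
split.
  apply: (leq_trans (size_scale_leq _ _)).
  apply: (leq_trans (size_polyD _ _)); rewrite size_polyN geq_max.
  by rewrite !(leq_trans (size_polyMleq _ _))// size_XsubC /= ltnS.
move=> i ia; rewrite hornerZ hornerD hornerN !hornerM !hornerXsubC.
set x := node N (j + b - a.+1%:Z + i%:Z).
apply: (@mulfI _ (a.+1%:R * step N)); first by rewrite mulf_neq0.
rewrite mulVKf ?mulf_neq0//.
have dx : (x - node N (j + b - a.+1%:Z)) - (x - node N (j + b)) = a.+1%:R * step N.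
  rewrite opprB addrC subrKA -mulrBl -intrB; congr (_ * _).
  by rewrite [RHS]pmulrn; congr (_%:~R); lia.
have pE : (x - node N (j + b - a.+1%:Z)) * p.[x]
    = (x - node N (j + b - a.+1%:Z)) * f x.
  case: i ia @x dx => [|i] ia x dx; first by rewrite /x addr0 subrr !mul0r.
  by rewrite /x (_ : _ + _ = j + b - a%:Z + i%:Z) ?ep//; lia.
have qE : (x - node N (j + b)) * q.[x] = (x - node N (j + b)) * f x.
  move: ia; rewrite leq_eqVlt => /predU1P[ia|ia].
    by rewrite /x (_ : _ + _ = j + b) ?subrr ?mul0r//; lia.
  by rewrite /x (_ : _ + _ = j + (b - 1) - a%:Z + i%:Z) ?eq//; lia.
by rewrite pE qE -mulrBl dx.
Qed.

Lemma interpolates_exists f N j a b : (0 < N)%N ->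
  exists p, interpolates f N j a b p.
Proof.
move=> N0; elim: a b => [|a IH] b.
  exists (f (node N (j + b)))%:P; split; first exact: size_polyC_leq1.
  by move=> [|//] _; rewrite hornerC subr0 addr0.
have [[p ip] [q iq]] := (IH b, IH (b - 1)).
by eexists; exact: neville_interpolates ip iq.
Qed.

Lemma interp_polyP f N j a b : (0 < N)%N ->
  interpolates f N j a b (interp_poly f N j a b).
Proof. by move=> N0; apply: xgetPex; exact: interpolates_exists. Qed.

Lemma interp_poly_eq f N j a b p : (0 < N)%N ->
  interpolates f N j a b p -> interp_poly f N j a b = p.
Proof. by move=> N0; apply: interpolates_unique => //; exact: interp_polyP. Qed.

Lemma eq_interp_poly f g N j a b : (0 < N)%N ->
  (forall i : nat, (i <= a)%N ->
     f (node N (j + b - a%:Z + i%:Z)) = g (node N (j + b - a%:Z + i%:Z))) ->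
  interp_poly f N j a b = interp_poly g N j a b.
Proof.
move=> N0 fg; have [sg eg] := interp_polyP g j a b N0.
by apply: interp_poly_eq => //; split=> // i ia; rewrite fg// eg.
Qed.

(** The value at [x_{j-1/2}] of the affine factor that Neville's recursion puts in
    front of the right-hand interpolant.  It depends neither on [N] nor on [j],
    which is why optimal weights independent of the grid exist. *)
Definition neville_weight (a : nat) b : R :=
  (a.+1%:R - b%:~R - 2^-1) / a.+1%:R.

Lemma neville_midpoint f N j a b : (0 < N)%N ->
  (interp_poly f N j a.+1 b).[midpoint N j] =
  neville_weight a b * (interp_poly f N j a b).[midpoint N j]
  + (1 - neville_weight a b) * (interp_poly f N j a (b - 1)).[midpoint N j].
Proof.
move=> N0.
have h0 : step N != 0 :> R by rewrite gt_eqF// step_gt0.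
have a0 : a.+1%:R != 0 :> R by rewrite pnatr_eq0.
have := neville_interpolates N0 (interp_polyP f j a b N0)
                                (interp_polyP f j a (b - 1) N0).
move=> /(interp_poly_eq N0) ->.
rewrite hornerZ hornerD hornerN !hornerM !hornerXsubC.
rewrite /neville_weight /midpoint /node !(intrD, intrN) -!pmulrn.
move: (_.[_]) (_.[_]) => P Q.
by move: a.+1%:R a0 => A A0; field; rewrite A0.
Qed.

Lemma interp_poly0 f N j b x : (0 < N)%N ->
  (interp_poly f N j 0 b).[x] = f (node N (j + b)).
Proof.
move=> N0; rewrite (@interp_poly_eq _ _ _ _ _ (f (node N (j + b)))%:P)//.
  by rewrite hornerC.
split; first exact: size_polyC_leq1.
by move=> [|//] _; rewrite hornerC subr0 addr0.
Qed.

(** The Lebesgue constant of a stencil at the midpoint is independent of the grid;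
    this controls the interpolants whose stencil crosses the jump. *)
Lemma interp_stable a b : exists2 K : R, 0 <= K &
  forall f N j B, (0 < N)%N ->
    (forall i : nat, (i <= a)%N ->
       `|f (node N (j + b - a%:Z + i%:Z))| <= B) ->
    `|(interp_poly f N j a b).[midpoint N j]| <= K * B.
Proof.
elim: a b => [|a IH] b.
  exists 1 => // f N j B N0 fB; rewrite interp_poly0// mul1r.
  by have := fB 0%N; rewrite subr0 addr0; exact.
have [K1 K10 IH1] := IH b; have [K2 K20 IH2] := IH (b - 1).
set w := neville_weight a b.
exists (`|w| * K1 + `|1 - w| * K2); first by rewrite addr_ge0// mulr_ge0.
move=> f N j B N0 fB; rewrite neville_midpoint// -/w.
rewrite (le_trans (ler_normD _ _))//.
rewrite [X in X + _ <= _]normrM [X in _ + X <= _]normrM mulrDl -!mulrA.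
rewrite lerD// ler_wpM2l//.
  apply: IH1 => // i ia; have := fB i.+1.
  rewrite (_ : _ + i.+1%:Z = j + b - a%:Z + i%:Z); first exact.
  by lia.
apply: IH2 => // i ia; have := fB i.
rewrite (_ : j + b - _ + _ = j + (b - 1) - a%:Z + i%:Z); last by lia.
by apply; rewrite ltnW.
Qed.

(** Turns the sums over the support of the weights into sums over a common
    range, in which they can be added. *)
Lemma sum_support (F : nat -> R) lo hi m : (hi < m)%N ->
  (forall k, ~~ (lo <= k <= hi)%N -> F k = 0) ->
  \sum_(lo <= k < hi.+1) F k = \sum_(0 <= k < m) F k.
Proof.
move=> him F0; rewrite (big_nat_widen _ _ m)// (big_nat_widenl _ 0)//.
rewrite big_mkcond; apply: eq_bigr => k _ /=.
by case: ifP => // /negbT nk; rewrite F0//; move: nk; rewrite ltnS andbC.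
Qed.

(** Induction on the number [n] of nodes beyond those of a small stencil: by
    Neville's recursion the weights of the larger stencil are an affine
    combination of those of the two stencils obtained by removing one end
    node. *)
Lemma optimal_weights_exist (r n b : nat) : (0 < r)%N -> (n <= b)%N ->
  exists c : nat -> R, is_optimal_weights r (r + n) b c.
Proof.
move=> r0; rewrite /is_optimal_weights addKn.
elim: n b => [|n IH] b nb.
  have supp (G : nat -> R) : \sum_(b - 0 <= k < b.+1) G k = G b.
    by rewrite subn0 big_nat1.
  exists (fun k => (k == b)%:R); rewrite addn0; split.
  - by move=> k; rewrite subn0 -eqn_leq eq_sym => /negbTE ->.
  - by rewrite supp eqxx.
  - by move=> f N j _; rewrite supp eqxx mul1r.
have [|c1 [c10 c1s c1p]] := IH b; first by lia.
case: b nb c10 c1s c1p => // b nb c10 c1s c1p.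
have [|c2 [c20 c2s c2p]] := IH b; first by lia.
pose w := neville_weight (r + n) b.+1%:Z.
pose c k := w * c1 k + (1 - w) * c2 k.
have c0 k : ~~ (b.+1 - n.+1 <= k <= b.+1)%N -> c k = 0.
  by move=> kb; rewrite /c c10 ?c20 ?mulr0 ?addr0//; lia.
have csum (G : nat -> R) : \sum_(b.+1 - n.+1 <= k < b.+2) c k * G k =
    w * (\sum_(b.+1 - n <= k < b.+2) c1 k * G k)
    + (1 - w) * (\sum_(b - n <= k < b.+1) c2 k * G k).
  rewrite [LHS](@sum_support _ _ _ b.+2)//; last first.
    by move=> k /c0 ->; rewrite mul0r.
  rewrite [X in _ = w * X + _](@sum_support _ _ _ b.+2)//; last first.
    by move=> k /c10 ->; rewrite mul0r.
  rewrite [X in _ = _ + _ * X](@sum_support _ _ _ b.+2)//; last first.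
    by move=> k /c20 ->; rewrite mul0r.
  rewrite !big_distrr -big_split/=; apply: eq_bigr => k _.
  by rewrite /c mulrDl !mulrA.
exists c; split=> //.
- have sum1 (F : nat -> R) lo hi :
      \sum_(lo <= k < hi) F k * 1 = \sum_(lo <= k < hi) F k.
    by apply: eq_bigr => k _; rewrite mulr1.
  have := csum (fun=> 1); rewrite !sum1.
  by rewrite c1s c2s !mulr1 addrC subrK.
- move=> f N j Nj; rewrite csum -c1p// -c2p// addnS neville_midpoint//.
    by congr (_ + _ * (interp_poly _ _ _ _ _).[_]); lia.
  by case: Nj; lia.
Qed.

End Interpolation.

(** * Nonlinear weights *)

Section Weights.
Context {R : realType}.
Implicit Types (f : R -> R) (N : nat) (j : int).

Lemma admissible_gt0 r N j : (0 < r)%N -> admissible r N j -> (0 < N)%N.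
Proof. by move=> r0 []; lia. Qed.

Lemma optimal_weightP (r a b : nat) : (0 < r <= a)%N -> (a - r <= b)%N ->
  is_optimal_weights r a b (@optimal_weight R r a b).
Proof.
move=> /andP[r0 ra] ab; apply: xgetPex.
by have := @optimal_weights_exist R r (a - r) b r0 ab; rewrite subnKC.
Qed.

Lemma optimal_weight_eq0 (r a b k : nat) : (0 < r <= a)%N -> (a - r <= b)%N ->
  ~~ (b - (a - r) <= k <= b)%N -> @optimal_weight R r a b k = 0.
Proof. by move=> ra ab; have [H _ _] := optimal_weightP ra ab; exact: H. Qed.

Lemma optimal_weight_sum (r a b : nat) : (0 < r <= a)%N -> (a - r <= b < r)%N ->
  \sum_(0 <= k < r) @optimal_weight R r a b k = 1.
Proof.
move=> ra /andP[ab br]; have [H0 H1 _] := optimal_weightP ra ab.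
by rewrite -(sum_support br H0).
Qed.

Lemma optimal_weight_interp (r a b : nat) f N j :
    (0 < r <= a)%N -> (a - r <= b < r)%N -> admissible r N j ->
  \sum_(0 <= k < r)
    optimal_weight r a b k * (interp_poly f N j r k%:Z).[midpoint N j] =
  (interp_poly f N j a b%:Z).[midpoint N j].
Proof.
move=> ra /andP[ab br] Nj; have [H0 _ ->//] := optimal_weightP ra ab.
by rewrite (sum_support br)// => k /H0 ->; rewrite mul0r.
Qed.

(** The coefficient of [h^-t] in [alpha_k], as a linear functional of the smoothness
    sensors: a large sensor can then be split off from the small ones. *)
Definition sensor_term (r k : nat) (g : int -> R) : R :=
  \sum_(k.+1 <= l < r) optimal_weight r (r + l - 1) (l - 1) k * g l%:Z
  + \sum_(0 <= l < k) optimal_weight r (2 * r - l - 2) (r - 1) k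
                      * g (- r%:Z + 1 + l%:Z).

Lemma alphaE (r : nat) f N j k :
  alpha r f N j k = optimal_weight r (2 * r - 1) (r - 1) k
                    + step N ^- texp r * sensor_term r k (J r f N j).
Proof. by rewrite /sensor_term mulrDr addrA. Qed.

Lemma sensor_term_bound (r : nat) : exists2 W : R, 0 <= W &
  forall k g B, (k < r)%N -> 0 <= B ->
    (forall xi : int, - r%:Z < xi < r%:Z -> `|g xi| <= B) ->
  `|sensor_term r k g| <= W * B.
Proof.
pose W1 k : R := \sum_(k.+1 <= l < r) `|optimal_weight r (r + l - 1) (l - 1) k|.
pose W2 k : R :=
  \sum_(0 <= l < k) `|optimal_weight r (2 * r - l - 2) (r - 1) k|.
have W10 k : 0 <= W1 k by exact: sumr_ge0.
have W20 k : 0 <= W2 k by exact: sumr_ge0.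
exists (\sum_(k < r) (W1 k + W2 k)).
  by apply: sumr_ge0 => k _; exact: addr_ge0.
move=> k g B kr B0 gB.
apply: (@le_trans _ _ ((W1 k + W2 k) * B)); last first.
  rewrite ler_wpM2r// (bigD1 (Ordinal kr))//= lerDl.
  by apply: sumr_ge0 => i _; exact: addr_ge0.
rewrite mulrDl !big_distrl/= (le_trans (ler_normD _ _))//.
apply: lerD; apply: (le_trans (ler_norm_sum _ _ _)); apply: ler_sum_nat => l lr.
  by rewrite normrM ler_wpM2l// gB//; lia.
by rewrite normrM ler_wpM2l// gB//; lia.
Qed.

Lemma sensor_term_split (r k : nat) (g : int -> R) (c : int) :
  sensor_term r k g = g c * sensor_term r k (fun xi => (xi == c)%:R)
                      + sensor_term r k (fun xi => if xi == c then 0 else g xi).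
Proof.
have gE xi : g xi = g c * (xi == c)%:R + (if xi == c then 0 else g xi).
  by case: eqP => [->|_]; rewrite ?mulr1 ?addr0// mulr0 add0r.
rewrite /sensor_term mulrDr addrACA; congr (_ + _).
  rewrite big_distrr -big_split/=; apply: eq_bigr => l _.
  by rewrite {1}gE mulrDr mulrCA.
rewrite big_distrr -big_split/=; apply: eq_bigr => l _.
by rewrite {1}gE mulrDr mulrCA.
Qed.

(** A large sensor at [xi = l0] activates exactly the weights of the stencil
    [x_{j-r}, ..., x_{j+l0-1}], the largest one that stays left of the jump.  For
    [k >= l0] the sensor is absent from [alpha_k] and the weight vanishes too. *)
Lemma sensor_term_right (r l0 k : nat) : (1 <= l0 < r)%N -> (k < r)%N ->
  sensor_term r k (fun xi => (xi == l0%:Z)%:R) =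
  optimal_weight r (r + l0 - 1) (l0 - 1) k.
Proof.
move=> l0r kr; rewrite /sensor_term [X in _ + X]big1_seq ?addr0; last first.
  move=> l /=; rewrite mem_index_iota => lk.
  by rewrite (_ : _ == _ = false) ?mulr0//; apply/negbTE; lia.
have [kl|lk] := ltnP k l0.
  rewrite (bigD1_seq l0) ?iota_uniq ?mem_index_iota//=; last by lia.
  rewrite eqxx mulr1 big1 ?addr0// => l ll0.
  by rewrite (_ : _ == _ = false) ?mulr0//; apply/negbTE; lia.
rewrite optimal_weight_eq0; [|lia..].
rewrite big1_seq// => l /=; rewrite mem_index_iota => kl.
by rewrite (_ : _ == _ = false) ?mulr0//; apply/negbTE; lia.
Qed.

(** The mirror image: the stencil is [x_{j-l0}, ..., x_{j+r-1}]. *)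
Lemma sensor_term_left (r l0 k : nat) : (1 <= l0 < r)%N -> (k < r)%N ->
  sensor_term r k (fun xi => (xi == - l0%:Z)%:R) =
  optimal_weight r (r + l0 - 1) (r - 1) k.
Proof.
move=> l0r kr; rewrite /sensor_term [X in X + _]big1_seq ?add0r; last first.
  move=> l /=; rewrite mem_index_iota => lk.
  by rewrite (_ : _ == _ = false) ?mulr0//; apply/negbTE; lia.
have [kl|lk] := ltnP (r - 1 - l0) k.
  rewrite (bigD1_seq (r - 1 - l0)%N) ?iota_uniq ?mem_index_iota//=.
  rewrite (_ : _ == _); last by lia.
  rewrite mulr1 big1 ?addr0 => [|l ll0].
    by congr (optimal_weight _ _ _ _); lia.
  by rewrite (_ : _ == _ = false) ?mulr0//; apply/negbTE; lia.
rewrite optimal_weight_eq0; [|lia..].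
rewrite big1_seq// => l /=; rewrite mem_index_iota => kl.
by rewrite (_ : _ == _ = false) ?mulr0//; apply/negbTE; lia.
Qed.

(** The normalised weights [al k / sum al] are insensitive to the factor [A]: the
    numerator of the error splits into [A] times the error of the [C]-average and
    the contribution of the perturbations [al k - A * C k], while the denominator
    is at least [A / 2]. *)
Lemma weighted_average_error (r : nat) (al C p : nat -> R) (y A e E Q : R) :
    0 < A -> 0 <= e -> r%:R * e <= 2^-1 ->
    \sum_(0 <= k < r) C k = 1 ->
    (forall k, (k < r)%N -> `|al k - A * C k| <= A * e) ->
    (forall k, (k < r)%N -> `|p k - y| <= Q) ->
    `|\sum_(0 <= k < r) C k * p k - y| <= E ->
  `|\sum_(0 <= k < r) al k / (\sum_(0 <= i < r) al i) * p k - y|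
    <= 2 * E + 2 * r%:R * e * Q.
Proof.
move=> A0 e0 re C1 alC pQ CE; set S := \sum_(0 <= i < r) al i.
pose d k := al k - A * C k.
have sum_le (F : nat -> R) b : (forall k, (k < r)%N -> `|F k| <= b) ->
    `|\sum_(0 <= k < r) F k| <= r%:R * b.
  move=> Fb; rewrite big_mkord (le_trans (ler_norm_sum _ _ _))//.
  have -> : r%:R * b = \sum_(k < r) b by rewrite sumr_const card_ord mulr_natl.
  by apply: ler_sum => k _; exact: Fb.
have SE : S = A + \sum_(0 <= k < r) d k.
  by rewrite /d big_split/= sumrN -big_distrr/= C1 mulr1 -/S; exact/esym/subrKC.
have Sge : A / 2 <= S.
  have := sum_le d (A * e) alC; rewrite ler_norml => /andP[+ _].
  by rewrite SE; nra.
have S0 : 0 < S by apply: lt_le_trans Sge; lra.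
have -> : \sum_(0 <= k < r) al k / S * p k - y =
    (A * (\sum_(0 <= k < r) C k * p k - y)
     + \sum_(0 <= k < r) d k * (p k - y)) / S.
  apply: (mulIf (lt0r_neq0 S0)); rewrite divfK ?gt_eqF//.
  rewrite mulrBl big_distrl/= mulrBr !big_distrr/=.
  have -> : A * y = \sum_(0 <= k < r) A * C k * y.
    by rewrite -big_distrl -big_distrr/= C1 mulr1.
  rewrite -!sumrB -big_split/=; apply: eq_bigr => k _.
  by rewrite /d mulrAC divfK ?gt_eqF//; ring.
rewrite normrM normfV (gtr0_norm S0) ler_pdivrMr//.
have dq : `|\sum_(0 <= k < r) d k * (p k - y)| <= A * (r%:R * e * Q).
  have -> : A * (r%:R * e * Q) = r%:R * (A * e * Q) by ring.
  by apply: sum_le => k kr; rewrite normrM ler_pM// ?alC// pQ.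
have Z0 : 0 <= r%:R * e * Q.
  by rewrite -(pmulr_rge0 _ A0) (le_trans _ dq).
have E0 : 0 <= E by apply: le_trans CE.
apply: (le_trans (ler_normD _ _)); rewrite [X in X + _]normrM (gtr0_norm A0).
have -> : 2 * E + 2 * r%:R * e * Q = 2 * (E + r%:R * e * Q) by ring.
have -> : 2 * (E + r%:R * e * Q) * S = (E + r%:R * e * Q) * (2 * S) by ring.
apply: (@le_trans _ _ ((E + r%:R * e * Q) * A)); last first.
  by rewrite ler_wpM2l ?addr_ge0//; lra.
by rewrite [leRHS]mulrC mulrDr lerD// ler_wpM2l// ltW.
Qed.

End Weights.

(** * Smooth data *)

Section Estimates.
Context {R : realType}.
Implicit Types (f g : R -> R) (N : nat) (j : int).

Lemma node_le N (i k : int) : i <= k -> node N i <= node N k :> R.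
Proof. by move=> ik; rewrite ler_wpM2r ?invr_ge0// ler_int. Qed.

Lemma midpoint_between N j : @node R N (j - 1) <= @midpoint R N j <= node N j.
Proof.
have h0 : 0 <= step N :> R by rewrite invr_ge0.
by rewrite /node /midpoint intrB !ler_wpM2r//; lra.
Qed.

Lemma node_unit N (i : int) : (0 < N)%N -> 0 <= i <= N%:Z ->
  0 <= @node R N i <= 1.
Proof.
move=> N0 /andP[i0 iN]; rewrite mulr_ge0 ?invr_ge0 ?ler0z//=.
by rewrite ler_pdivrMr ?ltr0n// mul1r [leRHS]pmulrn ler_int.
Qed.

Lemma window_node_unit (r : nat) N j (i : int) : (0 < r)%N ->
  admissible r N j -> - r%:Z <= i < r%:Z -> 0 <= @node R N (j + i) <= 1.
Proof.
move=> r0 Nj ir; apply: node_unit; first exact: admissible_gt0 Nj.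
by case: Nj; lia.
Qed.

Lemma midpoint_in_window (r : nat) N j : (0 < r)%N ->
  node N (j - r%:Z) <= @midpoint R N j <= node N (j + r%:Z - 1).
Proof.
move=> r0; have /andP[ml mr] := midpoint_between N j.
rewrite (le_trans _ ml)/=; last by apply: node_le; lia.
by rewrite (le_trans mr)//; apply: node_le; lia.
Qed.

Lemma midpoint_unit (r : nat) N j : (0 < r)%N -> admissible r N j ->
  0 <= @midpoint R N j <= 1.
Proof.
move=> r0 Nj; have /andP[ml mr] := midpoint_in_window N j r0.
have /andP[l0 _] : 0 <= @node R N (j + - r%:Z) <= 1.
  by apply: window_node_unit Nj _ => //; lia.
have /andP[_ r1] : 0 <= @node R N (j + (r%:Z - 1)) <= 1.
  by apply: window_node_unit Nj _ => //; lia.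
by rewrite (le_trans l0 ml)/= (le_trans mr)// -addrA.
Qed.

Lemma smooth_lipschitz f n M u v x y : smooth_bound n M u v f -> (0 < n)%N ->
  u <= x <= v -> u <= y <= v -> `|f x - f y| <= `|M| * `|x - y|.
Proof.
move=> sf n0 xuv yuv; rewrite distrC.
have := @interpolation_error _ f n M u v (f y)%:P [:: y] x `|x - y| sf isT.
rewrite hornerC expr1; apply=> //=.
- by move=> z; rewrite inE => /eqP ->.
- exact: size_polyC_leq1.
- by move=> z; rewrite inE => /eqP ->; rewrite hornerC.
- by move=> z; rewrite inE => /eqP ->.
Qed.

(** All nodes of the stencils considered are within [2 r h] of [x_{j-1/2}]. *)
Lemma stencil_error g n M u v N j (r a b : nat) : (0 < N)%N ->
    smooth_bound n M u v g -> (a < n)%N -> (a < 2 * r)%N -> (b < r)%N ->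
    u <= node N (j + b%:Z - a%:Z) -> node N (j + b%:Z) <= v ->
    u <= midpoint N j <= v ->
  `|(interp_poly g N j a b%:Z).[midpoint N j] - g (midpoint N j)|
    <= `|M| * ((2 * r)%:R * step N) ^+ a.+1.
Proof.
move=> N0 sg an ar br ux xv muv; have [sp ep] := interp_polyP g j a b%:Z N0.
pose s : seq R := [seq node N (j + b%:Z - a%:Z + i%:Z) | i <- iota 0 a.+1].
have ss : size s = a.+1 by rewrite size_map size_iota.
have sP (P : R -> Prop) : (forall i, (i <= a)%N ->
    P (node N (j + b%:Z - a%:Z + i%:Z))) -> {in s, forall x, P x}.
  by move=> Pi x /mapP[i]; rewrite mem_iota add0n ltnS => /andP[_ ia] ->; exact: Pi.
rewrite -ss; apply: (interpolation_error sg); rewrite ?ss//.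
- by rewrite map_inj_in_uniq ?iota_uniq// => x y _ _ /(node_inj N0); lia.
- apply: sP => i ia; rewrite (le_trans ux)/=; last by apply: node_le; lia.
  by rewrite (le_trans _ xv)//; apply: node_le; lia.
- exact: sP.
- apply: sP => i ia.
  rewrite /midpoint /node -mulrBl normrM (gtr0_norm (step_gt0 N0)).
  rewrite ler_wpM2r ?invr_ge0//.
  set i' := j + b%:Z - a%:Z + i%:Z.
  have lo : (- r%:Z)%:~R <= (j - i')%:~R :> R by rewrite ler_int /i'; lia.
  have hi : (j - i')%:~R <= ((2 * r)%:Z - 1)%:~R :> R by rewrite ler_int /i'; lia.
  move: lo hi; rewrite !intrB intrN -!pmulrn natrM.
  have : 1 <= r%:R :> R by rewrite ler1n (leq_ltn_trans _ br).
  move: (j%:~R : R) (i'%:~R : R) (r%:R : R) => x y z z0 lo hi.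
  by rewrite ler_norml; apply/andP; split; lra.
Qed.

Lemma near_step_small (c : R) : \forall N \near \oo,
  c * step N <= 2^-1.
Proof.
near=> N.
have N0 : 0 < N%:R :> R.
  by rewrite ltr0n; near: N; exists 1%N.
rewrite ler_pdivrMr// mulrC ler_pdivlMr//.
by near: N; exact: nbhs_infty_ger.
Unshelve. all: by end_near. Qed.

Lemma fhat_error (r a b : nat) f N j (y A e E Q : R) :
    (0 < r <= a)%N -> (a - r <= b < r)%N -> admissible r N j ->
    0 < A -> 0 <= e -> r%:R * e <= 2^-1 ->
    (forall k, (k < r)%N ->
       `|alpha r f N j k - A * optimal_weight r a b k| <= A * e) ->
    (forall k : nat, (k < r)%N ->
       `|(interp_poly f N j r k%:Z).[midpoint N j] - y| <= Q) ->
    `|(interp_poly f N j a b%:Z).[midpoint N j] - y| <= E ->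
  `|fhat r f N j - y| <= 2 * E + 2 * r%:R * e * Q.
Proof.
move=> ra ab Nj A0 e0 re al pQ pE.
apply: (weighted_average_error A0 e0 re) => //.
- exact: optimal_weight_sum ra ab.
- exact: al.
- by rewrite optimal_weight_interp.
Qed.

(** Sensors of size [(L h)^(2t)] still contribute only [O(h^t)] after the division
    by [h^t]. *)
Lemma sensor_scaling (h W L : R) t : 0 < h ->
  h ^- t * (W * (L * h) ^+ (2 * t)) = W * L ^+ (2 * t) * h ^+ t.
Proof.
move=> h0; rewrite exprMn mul2n -addnn (exprD h).
have : h ^+ t != 0 by rewrite expf_neq0// gt_eqF.
by move: (h ^+ t) => H H0; field.
Qed.

(** Here [A = 1], the target weights are those of the full stencil and the
    perturbations are [O(h^t)].  Multiplied by the [O(h^(r+1))] errors of the small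
    stencils they contribute [O(h^(3r))], which is dominated by the error
    [O(h^(2r))] of the full stencil. *)
Lemma smooth_accuracy (r : nat) f (M : R) : (2 <= r)%N ->
  exists K : R, \forall N \near \oo, forall j : int,
    admissible r N j ->
    smooth_bound (2 * r) M (node N (j - r%:Z)) (node N (j + r%:Z - 1)) f ->
    `|fhat r f N j - f (midpoint N j)| <= K * step N ^+ (2 * r).
Proof.
move=> r2; have r0 : (0 < r)%N by lia.
have rr : (0 < 2 * r)%N by lia.
have ra : (0 < r <= 2 * r - 1)%N by lia.
have ab : (2 * r - 1 - r <= r - 1 < r)%N by lia.
have r_lt : (r < 2 * r)%N by lia.
have t0 : (0 < texp r)%N by rewrite /texp; lia.
have tr : (2 * r <= texp r + r.+1)%N by rewrite /texp; lia.
have r2E : (2 * r)%N = (2 * r - 1).+1 by lia.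
have [W W0 WP] := @sensor_term_bound R r.
pose t := texp r; pose c := W * `|M| ^+ (2 * t).
have c0 : 0 <= c by rewrite mulr_ge0// exprn_ge0.
pose D : R := (2 * r)%:R.
exists (2 * (`|M| * D ^+ (2 * r)) + 2 * r%:R * c * (`|M| * D ^+ r.+1)).
near=> N.
have small : r%:R * c * step N <= 2^-1 by near: N; exact: near_step_small.
move=> j Nj sf.
have N0 := admissible_gt0 r0 Nj.
have h0 := @step_gt0 R N N0.
have h1 : step N <= 1 :> R by rewrite invf_le1 ?ltr0n// ler1n.
set h : R := step N in h0 h1 *.
have muv := midpoint_in_window N j r0.
have win (i : int) : - r%:Z <= i < r%:Z ->
    node N (j - r%:Z) <= @node R N (j + i) <= node N (j + r%:Z - 1).
  by move=> ir; rewrite !node_le//; clear -ir; lia.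
have stencil (a b : nat) : (a < 2 * r)%N -> (b < r)%N -> (a - r <= b)%N ->
    `|(interp_poly f N j a b%:Z).[midpoint N j] - f (midpoint N j)|
      <= `|M| * (D * h) ^+ a.+1.
  by move=> ar br ab'; apply: (stencil_error N0 sf) => //; apply: node_le;
    clear -br ab'; lia.
have ht : h ^+ t <= h.
  by rewrite -[leRHS]expr1 ler_wiXn2l ?(ltW h0).
have pQ (k : nat) : (k < r)%N ->
    `|(interp_poly f N j r k%:Z).[midpoint N j] - f (midpoint N j)|
      <= `|M| * (D * h) ^+ r.+1.
  by move=> kr; apply: stencil; rewrite ?subnn.
have pE : `|(interp_poly f N j (2 * r - 1) (r - 1)%N%:Z).[midpoint N j]
            - f (midpoint N j)| <= `|M| * (D * h) ^+ (2 * r).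
  rewrite {2}r2E; case/andP: ab => ab br; apply: stencil => //.
  by rewrite [ltnRHS]r2E.
have hr : h ^+ t * h ^+ r.+1 <= h ^+ (2 * r).
  by rewrite -exprD ler_wiXn2l ?(ltW h0).
have := @fhat_error r (2 * r - 1) (r - 1) f N j (f (midpoint N j)) 1 (c * h ^+ t)
  (`|M| * (D * h) ^+ (2 * r)) (`|M| * (D * h) ^+ r.+1) ra ab Nj ltr01.
move=> H; apply: (le_trans (H _ _ _ _ _)).
- by rewrite mulr_ge0// exprn_ge0// ltW.
- by apply: le_trans small; rewrite mulrA ler_wpM2l// mulr_ge0.
- move=> k kr; rewrite !mul1r alphaE addrC addKr normrM.
  rewrite gtr0_norm ?invr_gt0 ?exprn_gt0// -(sensor_scaling _ _ _ h0).
  rewrite ler_wpM2l ?invr_ge0 ?exprn_ge0 ?(ltW h0)//.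
  apply: WP => // [|xi xir]; first by rewrite exprn_ge0// mulr_ge0// ltW.
  rewrite /J ger0_norm ?exprn_ge0// lerXn2r ?nnegrE// ?mulr_ge0 ?(ltW h0)//.
  have dx : `|node N (j + xi) - node N (j + xi - 1)| = h.
    by rewrite /node -mulrBl -intrB opprB addrC subrK mul1r gtr0_norm.
  rewrite -dx; apply: (smooth_lipschitz sf) => //.
    by apply: win; clear -xir; lia.
  by rewrite -[j + xi - 1]addrA; apply: win; clear -xir; lia.
- exact: pQ.
- exact: pE.
rewrite !exprMn [leRHS]mulrDl; apply: lerD; first by rewrite !mulrA.
apply: (@le_trans _ _ (2 * r%:R * c * (`|M| * D ^+ r.+1) * (h ^+ t * h ^+ r.+1))).
  rewrite le_eqVlt; apply/orP; left; apply/eqP; ring.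
by rewrite ler_wpM2l// !mulr_ge0// exprn_ge0.
Unshelve. all: by end_near. Qed.

End Estimates.

(** * Data with a jump *)

Section Jump.
Context {R : realType}.
Implicit Types (f g : R -> R) (N : nat) (j : int).

Lemma interp_stable_uniform (r : nat) : exists2 K : R, 0 <= K &
  forall f N j B (k : nat), (0 < N)%N -> (k < r)%N -> 0 <= B ->
    (forall i : int, - r%:Z <= i < r%:Z -> `|f (node N (j + i))| <= B) ->
    `|(interp_poly f N j r k%:Z).[midpoint N j]| <= K * B.
Proof.
pose bound (k : nat) (K : R) := 0 <= K /\ forall f N j B, (0 < N)%N ->
  (forall i : nat, (i <= r)%N ->
     `|f (node N (j + k%:Z - r%:Z + i%:Z))| <= B) ->
  `|(interp_poly f N j r k%:Z).[midpoint N j]| <= K * B.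
have [K KP] : {K : nat -> R & forall k, bound k (K k)}.
  apply: choice => k; have [K K0 KP] := @interp_stable R r k%:Z.
  by exists K.
have K0 k : 0 <= K k by have [] := KP k.
exists (\sum_(k < r) K k); first by apply: sumr_ge0.
move=> f N j B k N0 kr B0 fB; have [_ H] := KP k.
apply: (@le_trans _ _ (K k * B)).
  apply: H => // i ir; rewrite -!addrA; apply: fB; lia.
rewrite ler_wpM2r// (bigD1 (Ordinal kr))//= lerDl.
by apply: sumr_ge0.
Qed.

(** The sensor at [c] is bounded below, so the weights are [A = h^-t J_c] times the
    optimal weights of the smooth stencil, up to [O(1)], that is, up to a relative
    error [O(h^t)].  Some of the small stencils now have errors that are only
    bounded, so the total is [O(h^(r+l0) + h^t)]; the second term is absorbed as
    [r + l0 <= 2r - 1 = t]. *)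
Lemma jump_accuracy (r l0 b : nat) (c : int) f (M L B dlt : R) :
    (2 <= r)%N -> (1 <= l0 < r)%N -> (l0 - 1 <= b < r)%N ->
    (forall k, (k < r)%N ->
       @sensor_term R r k (fun xi => (xi == c)%:R)
       = optimal_weight r (r + l0 - 1) b k) ->
    0 <= L -> 0 <= B -> 0 < dlt ->
  exists K : R, \forall N \near \oo, forall j g,
    admissible r N j -> smooth_bound (2 * r) M 0 1 g ->
    (forall i : nat, (i <= r + l0 - 1)%N ->
       f (node N (j + b%:Z - (r + l0 - 1)%N%:Z + i%:Z))
       = g (node N (j + b%:Z - (r + l0 - 1)%N%:Z + i%:Z))) ->
    f (midpoint N j) = g (midpoint N j) ->
    (forall xi : int, xi != c -> - r%:Z < xi < r%:Z ->
       `|f (node N (j + xi)) - f (node N (j + xi - 1))| <= L * step N) ->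
    (forall i : int, - r%:Z <= i < r%:Z -> `|f (node N (j + i))| <= B) ->
    `|f (midpoint N j)| <= B ->
    dlt <= `|f (node N (j + c)) - f (node N (j + c - 1))| ->
    `|fhat r f N j - f (midpoint N j)| <= K * step N ^+ (r + l0).
Proof.
move=> r2 l0r br.
have r0 : (0 < r)%N by lia.
have t0 : (0 < texp r)%N by rewrite /texp; lia.
have tr : (r + l0 <= texp r)%N by rewrite /texp; lia.
have ra : (0 < r <= r + l0 - 1)%N by lia.
have ab : (r + l0 - 1 - r <= b < r)%N by lia.
have a2r : (r + l0 - 1 < 2 * r)%N by lia.
have aE : (r + l0)%N = (r + l0 - 1).+1 by lia.
have first_node : - r%:Z <= b%:Z - (r + l0 - 1)%N%:Z < r%:Z by lia.
have last_node : - r%:Z <= b%:Z < r%:Z by lia.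
move=> cE L0 B0 d0.
have [W W0 WP] := @sensor_term_bound R r.
have [S S0 SP] := interp_stable_uniform r.
pose t := texp r.
(* [V] bounds the part of [alpha_k] that has no factor [h^-t]. *)
pose V : R := \sum_(k < r) `|optimal_weight r (2 * r - 1) (r - 1) k|.
have V0 : 0 <= V by apply: sumr_ge0.
pose e0 := (V + W * L ^+ (2 * t)) / dlt ^+ (2 * t).
have e00 : 0 <= e0.
  by rewrite divr_ge0 ?exprn_ge0 ?(ltW d0)// addr_ge0 ?mulr_ge0 ?exprn_ge0.
pose D : R := (2 * r)%:R.
exists (2 * (`|M| * D ^+ (r + l0)) + 2 * r%:R * e0 * (S * B + B)).
near=> N.
have small : r%:R * e0 * step N <= 2^-1 by near: N; exact: near_step_small.
move=> j g Nj sg fg fgm fL fB fmB fd.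
have N0 := admissible_gt0 r0 Nj.
have h0 := @step_gt0 R N N0.
have h1 : step N <= 1 :> R by rewrite invf_le1 ?ltr0n// ler1n.
set h : R := step N in h0 h1 fL *.
have ht : h ^+ t <= h.
  by rewrite -[leRHS]expr1 ler_wiXn2l ?(ltW h0).
have ht1 : h ^+ t <= 1 by exact: le_trans h1.
have ht0 : 0 < h ^+ t by exact: exprn_gt0.
have pE : `|(interp_poly f N j (r + l0 - 1) b%:Z).[midpoint N j]
            - f (midpoint N j)| <= `|M| * (D * h) ^+ (r + l0).
  rewrite (eq_interp_poly N0 fg) fgm {2}aE; case/andP: ab => _ br'.
  apply: (stencil_error N0 sg) => //.
  - by rewrite -addrA; have /andP[] := @window_node_unit R _ _ _ _ r0 Nj first_node.
  - by have /andP[] := @window_node_unit R _ _ _ _ r0 Nj last_node.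
  - exact: midpoint_unit r0 Nj.
have hr : h ^+ t <= h ^+ (r + l0) by rewrite ler_wiXn2l ?(ltW h0).
pose Jc := J r f N j c.
have Jd : dlt ^+ (2 * t) <= Jc by rewrite lerXn2r ?nnegrE// ltW.
have dt0 : 0 < dlt ^+ (2 * t) by exact: exprn_gt0.
have Jc0 : 0 < Jc by exact: lt_le_trans Jd.
have := @fhat_error R r (r + l0 - 1) b f N j (f (midpoint N j)) (h ^- t * Jc)
  (e0 * h ^+ t) (`|M| * (D * h) ^+ (r + l0)) (S * B + B) ra ab Nj.
move=> H; apply: (le_trans (H _ _ _ _ _ _)).
- by rewrite mulr_gt0// invr_gt0.
- by rewrite mulr_ge0// ltW.
- by apply: le_trans small; rewrite mulrA ler_wpM2l// mulr_ge0//.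
- move=> k kr.
  rewrite alphaE (sensor_term_split _ _ _ c) cE// -/Jc.
  set T := sensor_term _ _ _.
  have -> : optimal_weight r (2 * r - 1) (r - 1) k +
      step N ^- texp r * (Jc * optimal_weight r (r + l0 - 1) b k + T) -
      h ^- t * Jc * optimal_weight r (r + l0 - 1) b k =
      optimal_weight r (2 * r - 1) (r - 1) k + h ^- t * T.
    rewrite /h /t; ring.
  have -> : h ^- t * Jc * (e0 * h ^+ t) = e0 * Jc.
    by move: (h ^+ t) ht0 => z z0; field; rewrite gt_eqF.
  apply: (@le_trans _ _ (V + W * L ^+ (2 * t))); last first.
    by rewrite /e0 mulrAC ler_pdivlMr// ler_wpM2l// addr_ge0 ?mulr_ge0 ?exprn_ge0.
  apply: (le_trans (ler_normD _ _)); apply: lerD.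
    by rewrite /V (bigD1 (Ordinal kr))//= lerDl; apply: sumr_ge0.
  rewrite normrM gtr0_norm ?invr_gt0//.
  apply: (@le_trans _ _ (W * L ^+ (2 * t) * h ^+ t)); last first.
    by rewrite ler_piMr// mulr_ge0// exprn_ge0.
  rewrite -(sensor_scaling _ _ _ h0) ler_wpM2l ?invr_ge0 ?(ltW ht0)//.
  apply: WP => // [|xi xir]; first by rewrite exprn_ge0// mulr_ge0// ltW.
  case: eqP => [_|/eqP xic].
    by rewrite normr0 exprn_ge0// mulr_ge0// ltW.
  rewrite /J ger0_norm ?exprn_ge0// lerXn2r ?nnegrE// ?mulr_ge0 ?(ltW h0)//.
  exact: fL.
- move=> k kr; apply: (le_trans (ler_normB _ _)); apply: lerD => //.
  exact: SP.
- exact: pE.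
rewrite exprMn [leRHS]mulrDl; apply: lerD; first by rewrite !mulrA.
apply: (@le_trans _ _ (2 * r%:R * e0 * (S * B + B) * h ^+ t)).
  rewrite le_eqVlt; apply/orP; left; apply/eqP; ring.
have SB0 : 0 <= S * B + B by rewrite addr_ge0 ?mulr_ge0.
by rewrite ler_wpM2l// mulr_ge0// mulr_ge0// mulr_ge0.
Unshelve. all: by end_near. Qed.

Lemma smooth_boundW n (M M' u v : R) f : M <= M' ->
  smooth_bound n M u v f -> smooth_bound n M' u v f.
Proof.
by move=> MM' [? ? ? H]; split=> // i x ni xuv; exact: le_trans (H i x ni xuv) MM'.
Qed.

(** Deduces the grid-level hypotheses of [jump_accuracy] from the smoothness of the
    two branches.  For [c = l0] and for [c = -l0] the jump lies in
    [x_{j+c-1}, x_{j+c}], the only interval with a large sensor; the two cases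
    differ only in the branch [g] that the smooth stencil sees. *)
Lemma jump_side_accuracy (r l0 b : nat) (c : int) f g fm fp (xs M : R) :
    (2 <= r)%N -> (1 <= l0 < r)%N -> (l0 - 1 <= b < r)%N ->
    - r%:Z < c < r%:Z ->
    (forall k, (k < r)%N ->
       @sensor_term R r k (fun xi => (xi == c)%:R)
       = optimal_weight r (r + l0 - 1) b k) ->
    0 <= M -> smooth_bound (2 * r) M 0 1 fm -> smooth_bound (2 * r) M 0 1 fp ->
    smooth_bound (2 * r) M 0 1 g ->
    0 <= xs <= 1 -> fm xs != fp xs ->
    (forall N j, admissible r N j ->
       jump_in_window r f fm fp xs N j (j + c - 1) ->
       f (midpoint N j) = g (midpoint N j) /\
       forall i : int, b%:Z - (r + l0 - 1)%N%:Z <= i <= b%:Z ->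
         f (node N (j + i)) = g (node N (j + i))) ->
  exists K : R, \forall N \near \oo, forall j,
    admissible r N j -> jump_in_window r f fm fp xs N j (j + c - 1) ->
    `|fhat r f N j - f (midpoint N j)| <= K * step N ^+ (r + l0).
Proof.
move=> r2 l0r br; have r0 : (0 < r)%N by lia.
move=> cr cE M0 sm sp sg xs01 jmp fg.
pose d := `|fm xs - fp xs|.
have d0 : 0 < d by rewrite normr_gt0 subr_eq0.
pose B := `|fm 0| + `|fp 0| + `|g 0| + M.
have rr : (0 < 2 * r)%N by lia.
have lip q (x y : R) : smooth_bound (2 * r) M 0 1 q -> 0 <= x <= 1 -> 0 <= y <= 1 ->
    `|q x - q y| <= M * `|x - y|.
  by move=> sq x01 y01; rewrite -[in leRHS](ger0_norm M0) (smooth_lipschitz sq).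
have bnd q x : smooth_bound (2 * r) M 0 1 q -> 0 <= x <= 1 -> `|q x| <= `|q 0| + M.
  move=> sq x01; rewrite -[q x](subrK (q 0)) addrC (le_trans (ler_normD _ _))//.
  rewrite lerD2l (le_trans (lip _ _ _ sq x01 _)) ?lexx ?ler01//.
  by rewrite subr0 ger0_norm; case/andP: x01 => // _ x1; rewrite ler_piMr.
have [K HK] := @jump_accuracy r l0 b c f M M B (d / 2) r2 l0r br cE M0
  (addr_ge0 (addr_ge0 (addr_ge0 (normr_ge0 _) (normr_ge0 _)) (normr_ge0 _)) M0)
  (divr_gt0 d0 (ltr0Sn _ 1)).
exists K; apply: filterS2 HK (near_step_small (2 * M / d)) => N HN small j Nj jw.
(* Each branch moves by at most [d / 4] between [xs] and the neighbouring node,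
   which leaves a jump of at least [d / 2] between the two nodes. *)
have {}small : M * step N <= d / 4.
  by move: small; rewrite mulrAC ler_pdivrMr//; lra.
have N0 := admissible_gt0 r0 Nj.
have h0 := @step_gt0 R N N0.
have [fgm fgn] := fg N j Nj jw.
case: (Nj) => Nj1 Nj2; case: jw => /andP[xs1 xs2] jw.
have nu (i : int) : - r%:Z <= i < r%:Z -> 0 <= @node R N (j + i) <= 1.
  exact: window_node_unit r0 Nj.
have win (i : int) : - r%:Z <= i < r%:Z ->
    node N (j - r%:Z) <= @node R N (j + i) <= node N (j + r%:Z - 1).
  by move=> ir; rewrite !node_le//; clear -ir; lia.
have fleft (i : int) : - r%:Z <= i < c -> f (node N (j + i)) = fm (node N (j + i)).
  move=> ic; have [|H _] := jw (node N (j + i)).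
    by apply: win; clear -ic cr; lia.
  by apply: H; apply: node_le; clear -ic; lia.
have fright (i : int) : c <= i < r%:Z -> f (node N (j + i)) = fp (node N (j + i)).
  move=> ic; have [|_ H] := jw (node N (j + i)).
    by apply: win; clear -ic cr; lia.
  by apply: H; apply: node_le; clear -ic; lia.
have dh (i : int) : `|node N (j + i) - node N (j + i - 1)| = step N :> R.
  by rewrite /node -mulrBl -intrB opprB addrC subrK mul1r gtr0_norm.
apply: (HN j g) => //.
- move=> i ia; rewrite -!addrA; apply: fgn; clear -ia; lia.
- move=> xi xic xir; rewrite -(dh xi) -[j + xi - 1]addrA.
  have [xc|cx] := ltP xi c.
    by rewrite !fleft ?(lip _ _ _ sm)// ?nu//; clear -xir xc; lia.
  by rewrite !fright ?(lip _ _ _ sp)// ?nu//; clear -xir xic cx; lia.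
- move=> i ir; have [ic|ci] := ltP i c.
    rewrite fleft; last by rewrite ic andbT; case/andP: ir.
    apply: (le_trans (bnd _ _ sm (nu _ ir))).
    by rewrite /B; have := normr_ge0 (fp 0); have := normr_ge0 (g 0); lra.
  rewrite fright; last by rewrite ci; case/andP: ir.
  apply: (le_trans (bnd _ _ sp (nu _ ir))).
  by rewrite /B; have := normr_ge0 (fm 0); have := normr_ge0 (g 0); lra.
- rewrite fgm; apply: le_trans (bnd _ _ sg (midpoint_unit r0 Nj)) _.
  by rewrite /B; have := normr_ge0 (fm 0); have := normr_ge0 (fp 0); lra.
have left_ix : - r%:Z <= c - 1 < c by clear -cr; lia.
have right_ix : c <= c < r%:Z by rewrite lexx; case/andP: cr.
have left_in : 0 <= @node R N (j + (c - 1)) <= 1 by apply: nu; clear -cr; lia.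
have right_in : 0 <= @node R N (j + c) <= 1 by apply: nu; clear -cr; lia.
move: xs1 xs2; rewrite subrK -[j + c - 1]addrA => xs1 xs2.
rewrite fright// fleft//.
have gap : node N (j + c) - node N (j + (c - 1)) = step N :> R.
  rewrite -(dh c) -[j + c - 1]addrA ger0_norm// subr_ge0.
  exact: le_trans xs2.
have errm : `|fm (node N (j + (c - 1))) - fm xs| <= M * step N.
  apply: (le_trans (lip _ _ _ sm left_in xs01)); rewrite ler_wpM2l// -gap.
  by rewrite distrC ger0_norm ?subr_ge0// lerD2r.
have errp : `|fp (node N (j + c)) - fp xs| <= M * step N.
  apply: (le_trans (lip _ _ _ sp right_in xs01)); rewrite ler_wpM2l// -gap.
  by rewrite ger0_norm ?subr_ge0// lerD2l lerN2.
have dE : d <= `|fp (node N (j + c)) - fm (node N (j + (c - 1)))|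
    + (`|fm (node N (j + (c - 1))) - fm xs| + `|fp (node N (j + c)) - fp xs|).
  rewrite /d (_ : fm xs - fp xs =
    - (fp (node N (j + c)) - fm (node N (j + (c - 1))))
    - (fm (node N (j + (c - 1))) - fm xs) + (fp (node N (j + c)) - fp xs)).
    rewrite (le_trans (ler_normD _ _))// [leRHS]addrA lerD2r.
    by rewrite (le_trans (ler_normB _ _))// normrN.
  by ring.
by lra.
Qed.

End Jump.

Theorem theorem4p6 (R : realType) (r l0 : nat) (hr : (2 <= r)%N)
    (hl0 : (1 <= l0 <= r - 1)%N) (f : R -> R) :
  (forall M : R, exists K : R, \forall N \near \oo, forall j : int,
     admissible r N j ->
     smooth_bound (2 * r) M (node N (j - r%:Z)) (node N (j + r%:Z - 1)) f ->
     `|fhat r f N j - f (midpoint N j)| <= K * step N ^+ (2 * r))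
  /\
  (forall (fm fp : R -> R) (xs : R),
     smooth01 (2 * r) fm -> smooth01 (2 * r) fp ->
     0 <= xs <= 1 -> fm xs != fp xs ->
     exists K : R, \forall N \near \oo, forall j m : int,
       admissible r N j ->
       m = j - l0%:Z - 1 \/ m = j + l0%:Z - 1 ->
       jump_in_window r f fm fp xs N j m ->
       `|fhat r f N j - f (midpoint N j)| <= K * step N ^+ (r + l0)).
Proof.
have l0r : (1 <= l0 < r)%N by lia.
split=> [M|fm fp xs [M1 sm] [M2 sp] xs01 jmp]; first exact: smooth_accuracy.
have r0 : (0 < r)%N by lia.
pose M := `|M1| + `|M2|.
have M0 : 0 <= M by rewrite addr_ge0.
have {}sm : smooth_bound (2 * r) M 0 1 fm.
  apply: smooth_boundW sm; rewrite (le_trans (ler_norm _))// lerDl//.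
have {}sp : smooth_bound (2 * r) M 0 1 fp.
  apply: smooth_boundW sp; rewrite (le_trans (ler_norm _))// lerDr//.
have [Kr HKr] : exists K : R, \forall N \near \oo, forall j,
    admissible r N j -> jump_in_window r f fm fp xs N j (j + l0%:Z - 1) ->
    `|fhat r f N j - f (midpoint N j)| <= K * step N ^+ (r + l0).
  apply: (@jump_side_accuracy R r l0 (l0 - 1) l0%:Z f fm fm fp xs M) => //.
  - by clear -l0r; lia.
  - by clear -l0r; lia.
  - by move=> k kr; exact: sensor_term_right.
  move=> N j Nj [_ jw].
  have left y : node N (j - r%:Z) <= y -> y <= node N (j + l0%:Z - 1) ->
      f y = fm y.
    move=> y1 y2; have [|H _] := jw y; last exact: H.
    by rewrite y1 (le_trans y2)//; apply: node_le; clear -l0r; lia.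
  have /andP[m1 _] := @midpoint_in_window R r N j r0.
  have /andP[_ m2] := @midpoint_between R N j.
  split.
    apply: left => //; apply: (le_trans m2); apply: node_le.
    by clear -l0r; lia.
  by move=> i ib; apply: left; apply: node_le; clear -l0r ib; lia.
have [Kl HKl] : exists K : R, \forall N \near \oo, forall j,
    admissible r N j -> jump_in_window r f fm fp xs N j (j + - l0%:Z - 1) ->
    `|fhat r f N j - f (midpoint N j)| <= K * step N ^+ (r + l0).
  apply: (@jump_side_accuracy R r l0 (r - 1) (- l0%:Z) f fp fm fp xs M) => //.
  - by clear -l0r; lia.
  - by clear -l0r; lia.
  - by move=> k kr; exact: sensor_term_left.
  move=> N j Nj [_ jw].
  have right y : node N (j + - l0%:Z - 1 + 1) <= y -> y <= node N (j + r%:Z - 1) ->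
      f y = fp y.
    move=> y1 y2; have [|_ H] := jw y; last exact: H.
    by rewrite y2 andbT (le_trans _ y1)//; apply: node_le; clear -l0r; lia.
  have /andP[_ m2] := @midpoint_in_window R r N j r0.
  have /andP[m1 _] := @midpoint_between R N j.
  split.
    apply: right => //; apply: le_trans m1; apply: node_le.
    by clear -l0r; lia.
  by move=> i ib; apply: right; apply: node_le; clear -l0r ib; lia.
exists (`|Kr| + `|Kl|); apply: filterS2 HKr HKl => N HNr HNl j m Nj mE jw.
have hN : 0 <= step N ^+ (r + l0) :> R by rewrite exprn_ge0 ?invr_ge0.
case: mE jw => -> jw.
  apply: (le_trans (HNl j Nj jw)); rewrite ler_wpM2r//.
  by rewrite (le_trans (ler_norm _))// lerDr.
apply: (le_trans (HNr j Nj jw)); rewrite ler_wpM2r//.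
by rewrite (le_trans (ler_norm _))// lerDl.
Qed.
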